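(* Every nontrivial congruence equation fails in some finitary variety of logic, i.e., in some variety that is the equivalent algebraic semantics of some finitely algebraizable finitary logic.
   Context: A congruence equation is a formal equation between terms in binary symbols $\land,\lor,\circ$. It is satisfied by an algebra $\mathbf{B}$ if it holds whenever its variables are interpreted as congruences of $\mathbf{B}$, with $\alpha\land\beta:=\alpha\cap\beta$, $\alpha\lor\beta:=\Theta^{\mathbf{B}}(\alpha\cup\beta)$ (the congruence generated by $\alpha\cup\beta$) and $\alpha\circ\beta$ the relational product, applied to arbitrary binary relations on $B$. It is satisfied by a class if satisfied by every member; it is nontrivial if some algebra fails to satisfy it. A variety (class of similar algebras closed under homomorphic images, subalgebras and direct products) $\mathsf{K}$ is a finitary variety of logic if there are finite sets $I,J$, unary terms $\delta_i,\varepsilon_i$ ($i\in I$) and binary terms $\rho_j$ ($j\in J$) in the signature of $\mathsf{K}$ such that $\big(\&_{i\in I,\,j\in J}\ \delta_i(\rho_j(x,y))\approx\varepsilon_i(\rho_j(x,y))\big)\Longleftrightarrow x\approx y$ is valid in every member of $\mathsf{K}$. (Equivalently, $\mathsf{K}$ is the equivalent algebraic semantics of a finitely algebraizable finitary sentential logic.) *)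

(* Defs.v *)
From Stdlib Require Import Relation_Definitions RelationClasses ClassicalEpsilon.
From mathcomp Require Import all_boot.

Set Implicit Arguments.
Unset Strict Implicit.
Unset Printing Implicit Defensive.

Record signature := Signature {
  symbol : Type;
  arity : symbol -> nat
}.

Record algebra (S : signature) := Algebra {
  carrier :> Type;
  op : forall f : symbol S, ('I_(arity f) -> carrier) -> carrier;
  carrier_inhabited : inhabited carrier
}.

Arguments op {S} a f _.

Definition hom (S : signature) (A B : algebra S) (h : A -> B) : Prop :=
  forall (f : symbol S) (a : 'I_(arity f) -> A),
    h (op A f a) = op B f (fun i => h (a i)).

Lemma prod_inhabited (S : signature) (I : Type) (A : I -> algebra S) :
  inhabited (forall i, A i).
Proof.
by constructor=> i; exact: epsilon (carrier_inhabited (A i)) (fun _ => True).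
Qed.

Definition prod_algebra (S : signature) (I : Type) (A : I -> algebra S) :
    algebra S :=
  @Algebra S (forall i, A i) (fun f a i => op (A i) f (fun k => a k i))
    (prod_inhabited A).

Inductive term (S : signature) (V : Type) : Type :=
  | Var of V
  | App (f : symbol S) of ('I_(arity f) -> term S V).

Fixpoint eval (S : signature) (A : algebra S) (V : Type) (v : V -> A)
    (t : term S V) : A :=
  match t with
  | Var x => v x
  | App f a => op A f (fun i => eval v (a i))
  end.

Definition eval1 (S : signature) (A : algebra S) (t : term S 'I_1) (x : A) : A :=
  eval (fun _ => x) t.

Definition eval2 (S : signature) (A : algebra S) (t : term S 'I_2) (x y : A) : A :=
  eval (fun i : 'I_2 => if val i == 0 then x else y) t.

Record congruence (S : signature) (A : algebra S) (R : relation A) : Prop :=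
  Congruence {
    congruence_equiv : Equivalence R;
    congruence_compat : forall (f : symbol S) (a b : 'I_(arity f) -> A),
      (forall i, R (a i) (b i)) -> R (op A f a) (op A f b)
  }.

Definition cg (S : signature) (A : algebra S) (R : relation A) : relation A :=
  fun x y => forall C : relation A, congruence C ->
    (forall u v, R u v -> C u v) -> C x y.

Inductive cterm : Type :=
  | CVar of nat
  | CMeet of cterm & cterm
  | CJoin of cterm & cterm
  | CComp of cterm & cterm.

Fixpoint ceval (S : signature) (A : algebra S) (v : nat -> relation A)
    (t : cterm) : relation A :=
  match t with
  | CVar n => v n
  | CMeet s t => fun x y => ceval v s x y /\ ceval v t x y
  | CJoin s t => cg (fun x y => ceval v s x y \/ ceval v t x y)
  | CComp s t => fun x y => exists z, ceval v s x z /\ ceval v t z y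
  end.

Record congruence_equation := CongruenceEquation { lhs : cterm; rhs : cterm }.

Definition satisfies (S : signature) (A : algebra S) (e : congruence_equation) :
    Prop :=
  forall v : nat -> relation A, (forall n, congruence (v n)) ->
    forall x y : A, ceval v (lhs e) x y <-> ceval v (rhs e) x y.

Definition class_satisfies (S : signature) (K : algebra S -> Prop)
    (e : congruence_equation) : Prop :=
  forall A : algebra S, K A -> satisfies A e.

Definition nontrivial (e : congruence_equation) : Prop :=
  exists (S : signature) (A : algebra S), ~ satisfies A e.

(* Subalgebras are taken up to isomorphism, as domains of injective
   homomorphisms; closure under isomorphic copies is already part of closure
   under homomorphic images. *)
Record variety (S : signature) (K : algebra S -> Prop) : Prop := Variety {
  variety_img : forall (A B : algebra S) (h : A -> B),
    hom h -> (forall b, exists a, h a = b) -> K A -> K B;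
  variety_sub : forall (A B : algebra S) (h : A -> B),
    hom h -> injective h -> K B -> K A;
  variety_prod : forall (I : Type) (A : I -> algebra S),
    (forall i, K (A i)) -> K (prod_algebra A)
}.

Definition finitary_variety_of_logic (S : signature) (K : algebra S -> Prop) :
    Prop :=
  variety K /\
  exists (I J : finType) (delta epsilon : I -> term S 'I_1)
      (rho : J -> term S 'I_2),
    forall A : algebra S, K A -> forall x y : A,
      (forall (i : I) (j : J),
         eval1 (delta i) (eval2 (rho j) x y) =
         eval1 (epsilon i) (eval2 (rho j) x y))
      <-> x = y.

(* Main.v *)
(** For an algebra [A], the square [A * A], equipped with the basic operations
    of [A] acting coordinatewise, the maps [(a, b) |-> (a, a)] and
    [(a, b) |-> (b, b)] and the operation [(a, b), (c, d) |-> (a, d)], has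
    exactly the congruences [theta * theta] with [theta] a congruence of [A],
    and this correspondence respects meets, joins and relational products.  So
    a congruence equation failing in [A] fails in the square.  The square
    satisfies seven identities on the three new operations which force
    [x = y] to be equivalent to the equality of both coordinates of
    [(x_1, y_1)] and of [(x_2, y_2)], and these identities therefore define a
    finitary variety of logic. *)
From Stdlib Require Import Relation_Definitions RelationClasses.
From Stdlib Require Import FunctionalExtensionality ClassicalEpsilon.
From mathcomp Require Import all_boot.
Require Import Defs.

Set Implicit Arguments.
Unset Strict Implicit.
Unset Printing Implicit Defensive.

Lemma eval_hom (S : signature) (A B : algebra S) (h : A -> B) (V : Type)
    (v : V -> A) (t : term S V) :
  hom h -> h (eval v t) = eval (fun x => h (v x)) t.
Proof.
move=> hh; elim: t => [//|f a IH] /=.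
by rewrite hh; congr (op B f _); apply: functional_extensionality.
Qed.

Definition models (S : signature) (V : Type)
    (E : term S V -> term S V -> Prop) (A : algebra S) : Prop :=
  forall s t, E s t -> forall v : V -> A, eval v s = eval v t.

(** Easy half of Birkhoff's theorem: homomorphisms commute with evaluation, so identities transfer
    along surjections, injections and families of projections. *)
Lemma models_variety (S : signature) (V : Type)
    (E : term S V -> term S V -> Prop) : variety (models E).
Proof.
split=> [A B h hh surj_h KA s t Est v|A B h hh inj_h KB s t Est v|
         I A KA s t Est v].
(* Choice lifts the valuation through the surjection [h]. *)
- have [w hw] : exists w : V -> A, (fun x => h (w x)) = v.
    pose w x := constructive_indefinite_description _ (surj_h (v x)).
    exists (fun x => proj1_sig (w x)).
    by apply: functional_extensionality => x; exact: proj2_sig (w x).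
  by rewrite -hw -!eval_hom // (KA _ _ Est).
- by apply: inj_h; rewrite !eval_hom // (KB _ _ Est).
- apply: functional_extensionality_dep => i.
  have hi : @hom _ (prod_algebra A) (A i) (fun a => a i) by [].
  by rewrite (eval_hom v s hi) (eval_hom v t hi) (KA i _ _ Est).
Qed.

Inductive square_symbol (S : signature) : Type :=
  | Basic of symbol S
  | DiagFst
  | DiagSnd
  | Mix.

Definition square_signature (S : signature) : signature :=
  @Signature (square_symbol S) (fun f =>
    match f with Basic g => arity g | DiagFst | DiagSnd => 1 | Mix => 2 end).

Section SquareTerms.
Variables (S : signature) (V : Type).
Implicit Types s t : term (square_signature S) V.

Definition diag_fst t := @App (square_signature S) V (DiagFst S) (fun _ => t).
Definition diag_snd t := @App (square_signature S) V (DiagSnd S) (fun _ => t).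
Definition mix s t :=
  @App (square_signature S) V (Mix S) (fun i => if val i == 0 then s else t).

End SquareTerms.

(** The first four identities make both diagonal maps retractions onto one common image; the last
    three make [mix] the pairing inverse to them. *)
Inductive square_identity (S : signature) :
    term (square_signature S) bool -> term (square_signature S) bool -> Prop :=
  | fst_fst (x := Var _ true) :
      square_identity (diag_fst (diag_fst x)) (diag_fst x)
  | snd_fst (x := Var _ true) :
      square_identity (diag_snd (diag_fst x)) (diag_fst x)
  | fst_snd (x := Var _ true) :
      square_identity (diag_fst (diag_snd x)) (diag_snd x)
  | snd_snd (x := Var _ true) :
      square_identity (diag_snd (diag_snd x)) (diag_snd x)
  | fst_mix (x := Var _ true) (y := Var _ false) :
      square_identity (diag_fst (mix x y)) (diag_fst x)
  | snd_mix (x := Var _ true) (y := Var _ false) :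
      square_identity (diag_snd (mix x y)) (diag_snd y)
  | mix_fst_snd (x := Var _ true) :
      square_identity (mix (diag_fst x) (diag_snd x)) x.

(** In the square these terms yield [(x_1, y_1)] and [(x_2, y_2)]; such a pair lies on the diagonal
    exactly when [diag_fst] and [diag_snd] agree on it. *)
Definition logic_rho (S : signature) (j : bool) :
    term (square_signature S) 'I_2 :=
  if j then mix (diag_fst (Var _ ord0)) (diag_fst (Var _ ord_max))
  else mix (diag_snd (Var _ ord0)) (diag_snd (Var _ ord_max)).

Section SquareVariety.
Variables (S : signature) (A : algebra (square_signature S)).

Definition fst_op (x : A) : A := op A (DiagFst S) (fun _ => x).
Definition snd_op (x : A) : A := op A (DiagSnd S) (fun _ => x).
Definition mix_op (x y : A) : A :=
  op A (Mix S) (fun i => if val i == 0 then x else y).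

Section Eval.
Variables (V : Type) (v : V -> A).

Lemma eval_var x : eval v (Var _ x) = v x.
Proof. by []. Qed.

Lemma eval_fst t : eval v (diag_fst t) = fst_op (eval v t).
Proof. by []. Qed.

Lemma eval_snd t : eval v (diag_snd t) = snd_op (eval v t).
Proof. by []. Qed.

Lemma eval_mix s t : eval v (mix s t) = mix_op (eval v s) (eval v t).
Proof.
by congr (op A _ _); apply: functional_extensionality => i; case: ifP.
Qed.

End Eval.

Let evalE := (eval_var, eval_fst, eval_snd, eval_mix).

Lemma square_variety_logic (x y : A) :
  models (@square_identity S) A ->
  (forall j : bool,
     fst_op (eval2 (logic_rho S j) x y) = snd_op (eval2 (logic_rho S j) x y))
  <-> x = y.
Proof.
move=> KA; pose v z t (b : bool) : A := if b then z else t.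
have ff z : fst_op (fst_op z) = fst_op z by exact: KA (fst_fst S) (v z z).
have sf z : snd_op (fst_op z) = fst_op z by exact: KA (snd_fst S) (v z z).
have fs z : fst_op (snd_op z) = snd_op z by exact: KA (fst_snd S) (v z z).
have ss z : snd_op (snd_op z) = snd_op z by exact: KA (snd_snd S) (v z z).
have fm z t : fst_op (mix_op z t) = fst_op z.
  by have := KA _ _ (fst_mix S) (v z t); rewrite !evalE.
have sm z t : snd_op (mix_op z t) = snd_op t.
  by have := KA _ _ (snd_mix S) (v z t); rewrite !evalE.
have ms z : mix_op (fst_op z) (snd_op z) = z.
  by have := KA _ _ (mix_fst_snd S) (v z z); rewrite !evalE.
rewrite /eval2 /logic_rho; split=> [eq_xy|-> j].
  (* The two equations reduce to [fst_op x = fst_op y] and [snd_op x = snd_op y], and [ms] rebuilds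
     each element from these components. *)
  have := (eq_xy true, eq_xy false); rewrite !evalE /= !fm !sm ff sf fs ss.
  by case=> eq1 eq2; rewrite -(ms x) -(ms y) eq1 eq2.
by case: j; rewrite !evalE /= fm sm ?ff ?sf ?fs ?ss.
Qed.

End SquareVariety.

Lemma square_variety_of_logic (S : signature) :
  finitary_variety_of_logic (models (@square_identity S)).
Proof.
split; first exact: models_variety.
exists unit, bool, (fun _ => diag_fst (Var _ ord0)),
  (fun _ => diag_snd (Var _ ord0)), (logic_rho S) => A KA x y.
by rewrite -(square_variety_logic x y KA); split=> [rhoP j|rhoP _ j];
  [exact: rhoP tt j|exact: rhoP].
Qed.

Section Square.
Variables (S : signature) (A : algebra S).

Definition square_op (f : symbol (square_signature S)) :
    ('I_(arity f) -> A * A) -> A * A :=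
  match f with
  | Basic g => fun a =>
      (op A g (fun i => (a i).1), op A g (fun i => (a i).2))
  | DiagFst => fun a => ((a ord0).1, (a ord0).1)
  | DiagSnd => fun a => ((a ord0).2, (a ord0).2)
  | Mix => fun a => ((a ord0).1, (a ord_max).2)
  end.

Lemma square_inhabited : inhabited (A * A).
Proof. by case: (carrier_inhabited A) => a; constructor. Qed.

Definition square : algebra (square_signature S) :=
  Algebra square_op square_inhabited.

Lemma square_models : models (@square_identity S) square.
Proof. by move=> s t [] * /=; rewrite -?surjective_pairing. Qed.

Definition square_rel (R : relation A) : relation square :=
  fun x y => R x.1 y.1 /\ R x.2 y.2.

(** The diagonal maps copy one coordinate into the other; they preserve the relation because both
    coordinates carry the same [R]. *)
Lemma square_rel_congruence (R : relation A) :
  congruence R -> congruence (square_rel R).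
Proof.
case=> [[Rr Rs Rt] Rc]; split.
  split=> [x|x y [] *|x y z [? ?] [? ?]].
  - by split.
  - by split; apply: Rs.
  - by split; [apply: Rt (y.1) _ _ _|apply: Rt (y.2) _ _ _].
case=> [g|||] a b /= Rab; split=> /=; try by case: (Rab ord0).
- by apply: Rc => i; case: (Rab i).
- by apply: Rc => i; case: (Rab i).
- by case: (Rab ord_max).
Qed.

Definition diag_rel (C : relation square) : relation A :=
  fun a b => C (a, a) (b, b).

Lemma diag_rel_congruence (C : relation square) :
  congruence C -> congruence (diag_rel C).
Proof.
case=> [[Cr Cs Ct] Cc]; split.
  split=> [x|x y|x y z]; [exact: Cr|exact: Cs|exact: Ct].
move=> f a b Cab.
exact: (Cc (Basic f) (fun i => (a i, a i)) (fun i => (b i, b i))).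
Qed.

(** [Mix] rebuilds [(x1, x2)] from the diagonal pairs [(x1, x1)] and [(x2, x2)], so [C] is
    determined by its trace on the diagonal. *)
Lemma square_diag_rel (C : relation square) (x y : square) :
  congruence C -> square_rel (diag_rel C) x y -> C x y.
Proof.
case: x y => [x1 x2] [y1 y2] [_ Cc] [C1 C2].
have := Cc (Mix S) (fun i => if val i == 0 then (x1, x1) else (x2, x2))
  (fun i => if val i == 0 then (y1, y1) else (y2, y2)).
by apply=> i; case: ifP.
Qed.

Lemma cg_congruence (R : relation A) : congruence (cg R).
Proof.
split; first split.
- by move=> x C [[Cr _ _] _] _; exact: Cr.
- by move=> x y Rxy C cC RC; case: (cC) => [[_ Cs _] _]; exact: Cs (Rxy C cC RC).
- move=> x y z Rxy Ryz C cC RC; case: (cC) => [[_ _ Ct] _].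
  by apply: Ct (Rxy C cC RC) (Ryz C cC RC).
by move=> f a b Rab C cC RC; apply: (congruence_compat cC) => i; apply: Rab.
Qed.

Lemma ceval_square (v : nat -> relation A) (t : cterm) (x y : square) :
  ceval (fun n => square_rel (v n)) t x y <-> square_rel (ceval v t) x y.
Proof.
elim: t x y => [n|s IHs t IHt|s IHs t IHt|s IHs t IHt] x y //=.
- by rewrite IHs IHt /square_rel; tauto.
- split=> [|[cg1 cg2] C cC RC].
    (* The square of the join taken in [A] is itself a congruence containing both generating
       relations. *)
    apply; first exact/square_rel_congruence/cg_congruence.
    by move=> u w [/IHs|/IHt] [? ?]; split=> C _; apply; tauto.
  (* Conversely, the diagonal trace of [C] is a congruence of [A] containing the generators, hence
     the join. *)
  apply: square_diag_rel => //; have cD := diag_rel_congruence cC.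
  have RD a b : ceval v s a b \/ ceval v t a b -> diag_rel C a b.
    by case=> Rab; apply: RC; [left; apply/IHs|right; apply/IHt].
  by split; [apply: cg1|apply: cg2].
- split=> [[z [/IHs[? ?] /IHt[? ?]]]|[[z1 [? ?]] [z2 [? ?]]]].
    by split; [exists z.1|exists z.2].
  by exists (z1, z2); split; [apply/IHs|apply/IHt].
Qed.

Lemma square_satisfies (e : congruence_equation) :
  satisfies square e -> satisfies A e.
Proof.
move=> sat_e v cv x y.
(* On diagonal pairs, [square_rel R] says just [R x y]. *)
have := sat_e (fun n => square_rel (v n))
  (fun n => square_rel_congruence (cv n)) (x, x) (y, y).
by rewrite !ceval_square /square_rel /=; tauto.
Qed.

End Square.

Theorem theorem3p5 (e : congruence_equation) :
  nontrivial e ->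
  exists (S : signature) (K : algebra S -> Prop),
    finitary_variety_of_logic K /\ ~ class_satisfies K e.
Proof.
case=> S [A not_sat].
exists (square_signature S), (models (@square_identity S)).
split; first exact: square_variety_of_logic.
by move=> sat; apply/not_sat/square_satisfies/sat/square_models.
Qed.
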